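(* Let $N=\binom{n}{\lfloor n/2\rfloor}$. Let $\mathcal{F}$ be a $Q_2$-free family of subsets of $[n]$ and suppose $\mathcal{F}=\mathcal{S}\cup\mathcal{T}\cup\mathcal{U}$, where $\mathcal{S}$ is a subset of the set of minimal elements of $\mathcal{F}$, $\mathcal{U}$ is a subset of the set of maximal elements of $\mathcal{F}$, and $\mathcal{T}=\mathcal{F}\setminus(\mathcal{S}\cup\mathcal{U})$, such that for some integer $k$ and for any $T\in\mathcal{T}$, $S\in\mathcal{S}$, $U\in\mathcal{U}$ one has $|T|=k$, $|U|>k$, $|S|<k$. Then, as $n\to\infty$, $$|\mathcal{F}|\leq \frac{3+\sqrt{2}}{2}\,N+o(N)\leq 2.20711\,N+o(N),$$ where the $o(N)$ term depends only on $n$. In particular, if $\mathcal{F}$ is a $Q_2$-free family of subsets of $[n]$ contained in three layers of $Q_n$ (that is, the members of $\mathcal{F}$ have at most three different sizes), then $|\mathcal{F}|\leq 2.20711\,N+o(N)$.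
   Context: $[n]=\{1,\dots,n\}$; $Q_n$ is the lattice of all subsets of $[n]$ ordered by inclusion; the $i$th layer of $Q_n$ is $\binom{[n]}{i}$, the set of all $i$-element subsets of $[n]$. A family $\mathcal{F}$ of subsets of $[n]$ is $Q_2$-free if there are no four distinct sets $A,B,C,D\in\mathcal{F}$ with $A\subset B\subset D$ and $A\subset C\subset D$ (no condition is imposed on whether $B$ and $C$ are comparable). Minimal and maximal elements of $\mathcal{F}$ are with respect to inclusion. The notation $o(N)$ denotes a function $g(n)$ with $g(n)/N(n)\to0$ as $n\to\infty$. *)

(* Defs.v *)
From HB Require Import structures.
From mathcomp Require Import all_boot all_order all_algebra.
From mathcomp Require Import all_classical all_reals all_analysis.
Set Implicit Arguments.
Unset Strict Implicit.
Unset Printing Implicit Defensive.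
Import Order.TTheory GRing.Theory Num.Theory.
Import numFieldNormedType.Exports.

Local Open Scope ring_scope.
Local Open Scope classical_set_scope.

(* [uniq] forces the four sets to be distinct, so the non-strict inclusions
   below are strict; [B] and [C] may or may not be comparable. *)
Definition Q2_free (V : finType) (F : {set {set V}}) : Prop :=
  ~ exists A B C D : {set V},
      [/\ [&& A \in F, B \in F, C \in F & D \in F],
          uniq [:: A; B; C; D],
          (A \subset B) && (B \subset D)
        & (A \subset C) && (C \subset D)].

Definition layer (n i : nat) : {set {set 'I_n}} :=
  [set A : {set 'I_n} | #|A| == i]%SET.

Definition central_binomial (R : realType) (n : nat) : R := 'C(n, n./2)%:R.

Definition little_o_N (R : realType) (g : nat -> R) : Prop :=
  (g n / central_binomial R n) @[n --> \oo] --> (0 : R).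

(* 2.20711, split so that the unary numerals stay small. *)
Definition two_20711 (R : realType) : R := 2 + 207 / 10 ^+ 3 + 11 / 10 ^+ 5.

(* Main.v *)
Require Import Defs.
From HB Require Import structures.
From mathcomp Require Import all_boot all_order all_algebra.
From mathcomp Require Import all_classical all_reals all_analysis.
From mathcomp Require Import zify ring lra.
Set Implicit Arguments.
Unset Strict Implicit.
Unset Printing Implicit Defensive.
Import Order.TTheory GRing.Theory Num.Theory.
Import numFieldNormedType.Exports.

(** Write [N] for the middle binomial coefficient, [K = k], [L = n - k] and
[B = 'C(n, k)].

Reduction to three consecutive layers.  Since [S] consists of minimal members
it is an antichain below layer [k].  Replace it by the family [S'] of all
[(k-1)]-sets that contain a member of [S].  The normalized matching property
gives [#|S| / N <= #|S'| / 'C(n, k-1)] ([antichain_up_closure]): passing to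
the upper shadow never decreases density, and an antichain meets the shadow of
its lower part in the empty set.  Dually, [U] is replaced by the family [U'] of
all [(k+1)]-sets contained in a member of [U].  The absence of [Q_2] survives
in the form: at most one member of [T] lies between a member of [S'] and a
member of [U'] ([Q2_free_at_most_one]).

The three-layer count.  For [X] in [T], let [s] and [u] be the numbers of
members of [S'] just below and of [U'] just above [X]; let [a], [b], [p] be the
sums over [T] of [s], [u], [s * u].  Two kinds of inequalities are played
against each other.
- Many pairs force many triples: [(K - s) * (L - u) >= 0] gives
  [L * a + K * b <= p + K * L * #|T|], while counting the covering pairs at
  [S'], at [U'] gives [#|S'| * (L + 1) <= a + (B - #|T|) * K] and
  [#|U'| * (K + 1) <= b + (B - #|T|) * L].
- Triples are few: if [W] in [U'] covers [d] members of [T], and [X] is one of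
  them, then removing a point [y] from [X] can yield a member of [S'] only if
  [W :\ y] is not in [T]; so [s + d <= K + 1] and [W] is the top of at most
  [d * (K + 1 - d)] triples.  The same holds upside down for the members of
  [S'].
The quadratic bound is replaced by a tangent line at relative degree
[l = sqrt 2 - 1], the density of [T] below a member of [U'] in the optimal
configuration; then everything is linear, and adding up gives the density
[(3 + sqrt 2) / 2 + 1 / K + 1 / L] ([density_arith]).

Layers away from the middle.  If [k] is not between about [n / 6] and
[5 * n / 6], then [#|T| <= N / 5], and Sperner's theorem for [S] and [U] gives
[2 * N + N / 5], which is smaller than needed.  Otherwise [1 / K + 1 / L] is
[O(1 / n)].

For three arbitrary layers, take for [T] the layer in the middle, for [S] what
lies below and for [U] what lies above it. *)

(** * Double counting and cover degrees *)

Lemma weighted_sum_degree (V : finType) (e : rel V) (P Q : {set V})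
    (f : V -> nat) :
  \sum_(x in P) f x * #|[set y in Q | e x y]|
    = \sum_(y in Q) \sum_(x in P | e x y) f x.
Proof.
rewrite (exchange_big_dep (mem P)) /=; last by move=> y x _ /andP[].
apply: eq_bigr => x xP; rewrite -sum1dep_card big_distrr /=.
by apply: eq_big => [y|y _]; rewrite ?muln1 ?xP.
Qed.

Lemma sum_degree (V : finType) (e : rel V) (P Q : {set V}) :
  \sum_(x in P) #|[set y in Q | e x y]| = \sum_(y in Q) #|[set x in P | e x y]|.
Proof.
under eq_bigr => x _ do rewrite -[#|_|]mul1n.
by rewrite weighted_sum_degree; apply: eq_bigr => y _; rewrite sum1dep_card.
Qed.

(** Every edge between [P] and [Q] ends in [Q0], where it is counted by the
sum, or outside [Q0], where each vertex takes at most [q] edges. *)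
Lemma degree_bound (V : finType) (e : rel V) (P Q Q0 : {set V}) (p q : nat) :
  Q0 \subset Q ->
  {in P, forall x, #|[set y in Q | e x y]| = p} ->
  {in Q, forall y, #|[set x in P | e x y]| <= q} ->
  #|P| * p + #|Q0| * q
    <= \sum_(y in Q0) #|[set x in P | e x y]| + #|Q| * q.
Proof.
move=> Q0Q Pp Qq.
have -> : #|P| * p = \sum_(y in Q) #|[set x in P | e x y]|.
  by rewrite -sum_degree (eq_bigr (fun=> p)) // sum_nat_const.
rewrite (big_setID Q0) /= (finset.setIidPr Q0Q) -addnA leq_add2l.
have -> : #|Q| = #|Q0| + #|Q :\: Q0|.
  by rewrite -(cardsID Q0 Q) (finset.setIidPr Q0Q).
rewrite mulnDl addnC leq_add2l -sum_nat_const leq_sum // => y.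
by rewrite !inE => /andP[_ /Qq].
Qed.

Lemma card_up_degree (V : finType) (G : {set {set V}}) (A : {set V}) :
  {in G, forall B : {set _}, #|B| = #|A|.+1} ->
  #|[set B in G | A \subset B]| = #|[set x in ~: A | x |: A \in G]|.
Proof.
move=> GA.
rewrite -(@card_in_imset _ _ (fun x => x |: A)%SET); last first.
  move=> x y; rewrite !inE => /andP[xA _] /andP[yA _] /setP/(_ x).
  by rewrite !inE eqxx (negPf xA) !orbF => /esym/eqP.
apply: eq_card => B; rewrite !inE; apply/andP/imsetP => [[BG AB]|[x + ->]].
  have /cards1P[x Bx] : #|B :\: A| == 1.
    by rewrite cardsD (finset.setIidPr AB) GA // subSnn.
  have xB : x |: A = B.
    by rewrite -[RHS](finset.setID B A) (finset.setIidPr AB) Bx finset.setUC.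
  exists x; rewrite ?xB // !inE xB BG andbT.
  by have := set11 x; rewrite -Bx !inE => /andP[].
by rewrite !inE => /andP[xA ->]; rewrite finset.subsetUr.
Qed.

Lemma card_down_degree (V : finType) (G : {set {set V}}) (B : {set V}) :
  {in G, forall A : {set _}, #|B| = #|A|.+1} ->
  #|[set A in G | A \subset B]| = #|[set x in B | B :\ x \in G]|.
Proof.
move=> GB.
rewrite -(@card_in_imset _ _ (fun x => B :\ x)%SET); last first.
  move=> x y; rewrite !inE => /andP[xB _] /andP[yB _] /setP/(_ x).
  by rewrite !inE eqxx xB andbT; case: eqP.
apply: eq_card => A; rewrite !inE; apply/andP/imsetP => [[AG AB]|[x + ->]].
  have /cards1P[x Bx] : #|B :\: A| == 1.
    by rewrite cardsD (finset.setIidPr AB) (GB A) // subSnn.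
  have xB : B :\ x = A.
    rewrite -Bx finset.setDDr finset.setDv finset.set0U.
    exact/finset.setIidPr.
  exists x; rewrite ?xB // !inE xB AG andbT.
  by have := set11 x; rewrite -Bx !inE => /andP[].
by rewrite !inE => /andP[xA ->]; rewrite finset.subD1set.
Qed.

(** What remains of [Q_2]-freeness for the three families once the smallest
and the largest set have been replaced by sets next to the middle layer. *)
Definition at_most_one_between (V : finType) (S T U : {set {set V}}) : Prop :=
  forall A B C D, A \in S -> B \in T -> C \in T -> D \in U ->
    A \subset B -> B \subset D -> A \subset C -> C \subset D -> B = C.

(** The members of the left set correspond to points [x] of [B] with [B :\ x]
in [S], those of the right set to points [x] of [D] with [D :\ x] in [T].  A
common point [x] would put both [B] and [D :\ x] between [B :\ x] and [D], so
the two sets of points are disjoint subsets of [D]. *)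
Lemma degree_sum_down (V : finType) (S T U : {set {set V}}) (k : nat)
    (B D : {set V}) :
  at_most_one_between S T U ->
  {in S, forall A : {set _}, k = #|A|.+1} ->
  {in T, forall A : {set _}, #|A| = k} ->
  B \in T -> D \in U -> #|D| = k.+1 -> B \subset D ->
  #|[set A in S | A \subset B]| + #|[set C in T | C \subset D]| <= k.+1.
Proof.
move=> one Sk Tk BT DU Dk BD.
rewrite card_down_degree; last by move=> A /Sk <-; rewrite Tk.
rewrite card_down_degree; last by move=> A /Tk ->.
rewrite -Dk -cardsUI.
set X := [set x in B | _]; set Y := [set x in D | _].
have -> : X :&: Y = finset.set0.
  apply/setP=> x; rewrite !inE; apply/negP => /andP[/andP[xB BxS] /andP[xD DxT]].
  have BDx : B = D :\ x.
    apply: (one _ _ _ _ BxS BT DxT DU) => //; rewrite ?finset.subD1set //.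
    exact: finset.setSD.
  by move: xB; rewrite BDx !inE eqxx.
rewrite cards0 addn0 subset_leq_card // finset.subUset.
apply/andP; split; apply/fintype.subsetP => x; rewrite inE => /andP[xB _] //.
exact: (fintype.subsetP BD).
Qed.

(** The order dual of [degree_sum_down]: here the points are added, and they
form disjoint subsets of the complement of [A]. *)
Lemma degree_sum_up (n : nat) (S T U : {set {set 'I_n}}) (k : nat)
    (A B : {set 'I_n}) :
  at_most_one_between S T U ->
  {in U, forall D : {set _}, #|D| = k.+1} ->
  {in T, forall B : {set _}, #|B| = k} ->
  A \in S -> B \in T -> k = #|A|.+1 -> A \subset B ->
  #|[set D in U | B \subset D]| + #|[set C in T | A \subset C]|
    <= (n - k).+1.
Proof.
move=> one Uk Tk AS BT Ak AB.
rewrite card_up_degree; last by move=> D /Uk ->; rewrite Tk.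
rewrite card_up_degree; last by move=> D /Tk ->.
set X := [set x in ~: B | _]; set Y := [set x in ~: A | _].
have -> : (n - k).+1 = #|~: A|.
  rewrite cardsCs finset.setCK card_ord; have := max_card (mem B).
  by rewrite (Tk _ BT) card_ord Ak; lia.
rewrite -cardsUI.
have -> : X :&: Y = finset.set0.
  apply/setP=> x; rewrite !inE; apply/negP => /andP[/andP[xB BxU] /andP[xA AxT]].
  have BAx : B = x |: A.
    apply: (one _ _ _ _ AS BT AxT BxU) => //; rewrite ?finset.subsetUr //.
    exact: finset.setUS.
  by move: xB; rewrite BAx !inE eqxx.
rewrite cards0 addn0 subset_leq_card // finset.subUset.
apply/andP; split; apply/fintype.subsetP => x; rewrite !inE => /andP[xB _] //.
exact: contra (fintype.subsetP AB x) xB.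
Qed.

(** * Layers, shadows and antichains *)

Lemma bin_half_max (n m : nat) : 'C(n, m) <= 'C(n, n./2).
Proof.
have inc i : i < n./2 -> 'C(n, i) <= 'C(n, i.+1).
  move=> i_half; rewrite -(leq_pmul2l (ltn0Sn i)) mul_bin_left.
  by rewrite leq_mul2r orbC; apply/orP; left; lia.
have low i j : i + j = n./2 -> 'C(n, i) <= 'C(n, n./2).
  elim: j i => [|j IHj] i ij; first by rewrite -ij addn0.
  by apply: leq_trans (inc i _) (IHj _ _); lia.
have [m_le|m_gt] := leqP m n./2; first by apply: (low _ (n./2 - m)); lia.
have [mn|] := leqP m n; last by move=> /bin_small ->.
by rewrite -(bin_sub mn); apply: (low _ (n./2 - (n - m))); lia.
Qed.

Lemma card_layer (n i : nat) : #|layer n i| = 'C(n, i).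
Proof. by rewrite card_draws card_ord. Qed.

Lemma card_setC_ord (n : nat) (A : {set 'I_n}) : #|~: A| = n - #|A|.
Proof. by rewrite cardsCs finset.setCK card_ord. Qed.

Lemma layer_up_degree (n m : nat) (A : {set 'I_n}) : #|A| = m ->
  #|[set B in layer n m.+1 | A \subset B]| = n - m.
Proof.
move=> Am; rewrite card_up_degree; last by move=> B; rewrite inE Am => /eqP.
rewrite -Am -card_setC_ord.
apply: eq_card => x; rewrite !inE.
by case: (boolP (x \in A)) => //= xA; rewrite cardsU1 xA add1n eqxx.
Qed.

Lemma layer_down_degree (n m : nat) (B : {set 'I_n}) : #|B| = m.+1 ->
  #|[set A in layer n m | A \subset B]| = m.+1.
Proof.
move=> Bm; rewrite card_down_degree; last by move=> A; rewrite inE => /eqP ->.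
rewrite -Bm; apply: eq_card => x; rewrite !inE.
case: (boolP (x \in B)) => //= xB; move: (cardsD1 x B).
by rewrite Bm xB add1n => -[<-]; rewrite eqxx.
Qed.

Lemma down_degree_le (n m : nat) (P : {set {set 'I_n}}) (B : {set 'I_n}) :
  P \subset layer n m -> #|B| = m.+1 -> #|[set A in P | A \subset B]| <= m.+1.
Proof.
move=> Pm Bm; rewrite -[X in _ <= X](layer_down_degree Bm) subset_leq_card //.
by apply/fintype.subsetP => A; rewrite !inE => /andP[/(fintype.subsetP Pm)];
  rewrite inE => -> ->.
Qed.

Lemma up_degree_le (n m : nat) (P : {set {set 'I_n}}) (A : {set 'I_n}) :
  P \subset layer n m.+1 -> #|A| = m -> #|[set B in P | A \subset B]| <= n - m.
Proof.
move=> Pm Am; rewrite -[X in _ <= X](layer_up_degree Am) subset_leq_card //.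
by apply/fintype.subsetP => B; rewrite !inE => /andP[/(fintype.subsetP Pm)];
  rewrite inE => -> ->.
Qed.

Definition up_closure (n m : nat) (S : {set {set 'I_n}}) : {set {set 'I_n}} :=
  [set B in layer n m | [exists A in S, A \subset B]].

Definition antichain (V : finType) (S : {set {set V}}) : Prop :=
  {in S &, forall A B : {set V}, A \subset B -> A = B}.

Lemma up_closureP (n m : nat) (S : {set {set 'I_n}}) (B : {set 'I_n}) :
  reflect (#|B| = m /\ exists2 A, A \in S & A \subset B) (B \in up_closure m S).
Proof.
rewrite !inE; apply: (iffP andP) => -[].
  by move=> /eqP Bm /existsP[A /andP[AS AB]]; split=> //; exists A.
by move=> -> [A AS AB]; split=> //; apply/existsP; exists A; rewrite AS.
Qed.

(** Count the covering pairs between the two closures: every set of the lower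
one has all its [n - m] upper covers in the upper one. *)
Lemma normalized_matching (n m : nat) (S : {set {set 'I_n}}) :
  #|up_closure m S| * (n - m) <= #|up_closure m.+1 S| * m.+1.
Proof.
have := @degree_bound _ (fun A B : {set 'I_n} => A \subset B)
  (up_closure m S) (up_closure m.+1 S) finset.set0 (n - m) m.+1
  (finset.sub0set _).
rewrite cards0 mul0n addn0 big_set0 add0n; apply.
  move=> A /up_closureP[Am [A0 A0S A0A]].
  rewrite -[RHS](layer_up_degree Am); apply: eq_card => B; rewrite !inE.
  case: (boolP (A \subset B)) => [AB|]; rewrite ?andbF ?andbT //.
  case: eqP => //= _; apply/existsP; exists A0; rewrite A0S.
  exact: fintype.subset_trans AB.
move=> B /up_closureP[Bm _]; apply: down_degree_le Bm.
by apply/fintype.subsetP => A; rewrite inE => /andP[].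
Qed.

(** A strengthening of Sperner's theorem: the density of [up_closure m S] in
its layer is at least [#|S|] divided by the middle binomial coefficient.  By
induction on [m], this holds for the part of [S] below layer [m.+1] and its
closure in layer [m]; the step to the closure in layer [m.+1] is
[normalized_matching], and the members of [S] in layer [m.+1] itself are new
because [S] is an antichain. *)
Lemma antichain_up_closure (n m : nat) (S : {set {set 'I_n}}) :
  m <= n -> antichain S -> {in S, forall A : {set _}, #|A| <= m} ->
  #|S| * 'C(n, m) <= 'C(n, n./2) * #|up_closure m S|.
Proof.
elim: m S => [|m IHm] S mn antiS Sm.
  rewrite bin0 muln1 (leq_trans (_ : _ <= #|up_closure 0 S|)) //; last first.
    by rewrite leq_pmull // bin_gt0; lia.
  apply: subset_leq_card; apply/fintype.subsetP => A AS; apply/up_closureP.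
  by split; [apply/eqP; rewrite -leqn0 Sm|exists A].
(* [S1] is the part of [S] strictly below layer [m.+1]. *)
pose S1 := [set A in S | #|A| <= m]%SET.
have S1S : S1 \subset S by apply/fintype.subsetP => A; rewrite inE => /andP[].
have S1P : #|S1| * 'C(n, m) <= 'C(n, n./2) * #|up_closure m S1|.
  apply: IHm; first exact: ltnW.
    by move=> A B /(fintype.subsetP S1S) AS /(fintype.subsetP S1S) BS; apply: antiS.
  by move=> A; rewrite inE => /andP[].
have S1up : #|S1| * 'C(n, m.+1) <= 'C(n, n./2) * #|up_closure m.+1 S1|.
  rewrite -(leq_pmul2r (ltn0Sn m)) -mulnA [_ * m.+1]mulnC mul_bin_left.
  rewrite -[X in _ <= X]mulnA.
  apply: leq_trans (leq_mul (leqnn _) (normalized_matching m S1)).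
  by rewrite [(n - m) * _]mulnC !mulnA leq_mul2r S1P orbT.
have disj : (S :\: S1) :&: up_closure m.+1 S1 = finset.set0.
  apply/setP => B; rewrite finset.in_setI finset.in_setD finset.in_set0; apply/negP.
  move=> /andP[/andP[BS1 BS] /up_closureP[_ [A AS1 AB]]].
  have AS := fintype.subsetP S1S _ AS1.
  by rewrite -(antiS _ _ AS BS AB) AS1 in BS1.
have sub : (S :\: S1) :|: up_closure m.+1 S1 \subset up_closure m.+1 S.
  apply/fintype.subsetP => B /finset.setUP[|/up_closureP[Bm [A AS1 AB]]].
    rewrite !inE => /andP[BS1 BS].
    have Bm := Sm _ BS; apply/andP; split.
      by rewrite eqn_leq Bm ltnNge; move: BS1; rewrite BS.
    by apply/existsP; exists B; rewrite BS subxx.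
  by apply/up_closureP; split=> //; exists A => //; apply: (fintype.subsetP S1S).
rewrite -(cardsID S1 S) (finset.setIidPr S1S) mulnDl.
have := subset_leq_card sub.
rewrite -[X in X <= _]addn0 -[X in _ + X](@cards0 {set 'I_n}) -disj cardsUI.
move=> card_le.
apply: leq_trans (leq_mul (leqnn _) card_le).
by rewrite mulnDr addnC leq_add // mulnC leq_mul2r bin_half_max orbT.
Qed.

Lemma sperner (n : nat) (S : {set {set 'I_n}}) :
  antichain S -> #|S| <= 'C(n, n./2).
Proof.
move=> antiS; have := @antichain_up_closure n n S (leqnn n) antiS.
rewrite binn muln1 => /(_ _)/leq_trans; apply.
  by move=> A _; rewrite -[X in _ <= X](card_ord n) max_card.
have : #|up_closure n S| <= #|layer n n|.
  by apply: subset_leq_card; apply/fintype.subsetP => A; rewrite inE => /andP[].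
by rewrite card_layer binn => up1; rewrite -[X in _ <= X]muln1 leq_mul.
Qed.

Definition down_closure (n m : nat) (U : {set {set 'I_n}}) : {set {set 'I_n}} :=
  [set A in layer n m | [exists B in U, A \subset B]].

Lemma down_closureP (n m : nat) (U : {set {set 'I_n}}) (A : {set 'I_n}) :
  reflect (#|A| = m /\ exists2 B, B \in U & A \subset B) (A \in down_closure m U).
Proof.
rewrite !inE; apply: (iffP andP) => -[].
  by move=> /eqP Am /existsP[B /andP[BU AB]]; split=> //; exists B.
by move=> -> [B BU AB]; split=> //; apply/existsP; exists B; rewrite BU.
Qed.

(** Complementation turns this into [antichain_up_closure]. *)
Lemma antichain_down_closure (n m : nat) (U : {set {set 'I_n}}) :
  m <= n -> antichain U -> {in U, forall A : {set _}, m <= #|A|} ->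
  #|U| * 'C(n, m) <= 'C(n, n./2) * #|down_closure m U|.
Proof.
move=> mn antiU Um.
pose compl (G : {set {set 'I_n}}) := [set ~: A | A in G].
have -> : #|U| = #|compl U| by rewrite card_imset //; exact: finset.setC_inj.
have -> : #|down_closure m U| = #|up_closure (n - m) (compl U)|.
  rewrite -(card_imset _ (@finset.setC_inj 'I_n)); apply: eq_card => B.
  apply/imsetP/up_closureP => [[A /down_closureP[Am [D DU AD]] ->]|].
    split; first by rewrite card_setC_ord Am.
    by exists (~: D); rewrite ?imset_f // finset.setCS.
  move=> [Bm [_ /imsetP[D DU ->]]] DB.
  exists (~: B); rewrite ?finset.setCK //; apply/down_closureP; split.
    by rewrite card_setC_ord Bm subKn.
  by exists D => //; rewrite -finset.setCS finset.setCK.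
rewrite -(bin_sub mn); apply: antichain_up_closure (leq_subr _ _) _ _.
  move=> _ _ /imsetP[A AU ->] /imsetP[B BU ->].
  by rewrite finset.setCS => /antiU ->.
by move=> _ /imsetP[A /Um mA ->]; rewrite card_setC_ord leq_sub2l.
Qed.

Local Open Scope ring_scope.

(** * The three-layer inequality *)

(** Bound on the number of triples through [T] and [U], where [s] counts the
first halves: an element [D] of [U] with [d] neighbours in [T] accounts for at
most [d * (m.+1 - d)] of them, and this concave function of [d] is replaced by
a tangent line whose slope is governed by the free parameter [l].  The relation
is abstract so that the lemma applies both to inclusion and to its converse. *)
Lemma flag_bound (R : realDomainType) (V : finType) (e : rel V)
    (T U : {set V}) (s : V -> nat) (m : nat) (l : R) :
  {in T & U, forall B D, e B D ->
    (s B + #|[set C in T | e C D]| <= m.+1)%N} ->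
  (\sum_(B in T) s B * #|[set D in U | e B D]|)%:R
    <= (1 - 2 * l) * m%:R * (\sum_(B in T) #|[set D in U | e B D]|)%:R
       + (l ^+ 2 * m%:R + 1) * (#|U| * m.+1)%:R.
Proof.
move=> sT; rewrite weighted_sum_degree sum_degree !natr_sum.
rewrite -sum1_card big_distrl /= natr_sum !big_distrr -big_split /=.
apply: ler_sum => D DU; rewrite mul1n.
set d := #|[set C in T | e C D]|.
have sd : (\sum_(B in T | e B D) s B + d * d <= d * m.+1)%N.
  rewrite {1 3}/d -sum1dep_card !big_distrl /= -big_split /= leq_sum //.
  by move=> B /andP[BT BD]; rewrite !mul1n sT.
have dm : (d <= m.+1)%N.
  have [d0|[B]] := set_0Vmem [set C in T | e C D].
    by rewrite /d d0 cards0.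
  rewrite inE => /andP[BT BD].
  exact: leq_trans (leq_addl _ _) (sT _ _ BT DU BD).
move: sd dm; rewrite -(ler_nat R) -[(d <= _)%N](ler_nat R) natrD !natrM.
have -> : m.+1%:R = m%:R + 1 :> R by rewrite -natr1.
have := ler0n R m.
(* Convexity: the square of [d] lies above its tangent line at [l * m]. *)
have := sqr_ge0 (d%:R - l * m%:R : R).
have := sqr_ge0 (l : R); nra.
Qed.

(** The linear programme behind the constant.  With [l = r - 1] one has
[l ^+ 2 = 1 - 2 * l], which makes [X * L + Y * K] and [t * (K * L)] enter the
combined inequality with the same coefficient [4 * r - 4]; dividing by it is
multiplying by [(r + 1) / 4]. *)
Lemma density_arith (R : realFieldType) (r B K L X Y t a b p : R) :
  0 <= r -> r ^+ 2 = 2 -> 0 <= B -> 0 <= K -> 0 <= L ->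
  X <= B * K -> Y <= B * L ->
  X + t * K <= a + B * K -> Y + t * L <= b + B * L ->
  L * a + K * b <= p + K * L * t ->
  p <= (1 - 2 * (r - 1)) * K * b + ((r - 1) ^+ 2 * K + 1) * Y ->
  p <= (1 - 2 * (r - 1)) * L * a + ((r - 1) ^+ 2 * L + 1) * X ->
  X * L + Y * K + t * (K * L) <= (3 + r) / 2 * (B * (K * L)) + B * (K + L).
Proof.
move=> r0 r2 B0 K0 L0 XB YB hX hY hp pU pS.
have r1 : 1 <= r by rewrite -(ler_pXn2r (ltn0Sn 1)) ?nnegrE // r2 expr1n; lra.
have r32 : r <= 3 / 2.
  by rewrite -(ler_pXn2r (ltn0Sn 1)) ?nnegrE // ?r2 ?expr2; lra.
have lE : (r - 1) ^+ 2 = 3 - 2 * r by rewrite sqrrB r2; ring.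
rewrite lE in pU pS.
have hXL : X * L + t * (K * L) <= L * a + B * (K * L).
  by have := ler_wpM2l L0 hX; nra.
have hYK : Y * K + t * (K * L) <= K * b + B * (K * L).
  by have := ler_wpM2l K0 hY; nra.
set Z := X * L + Y * K; set M := K * L in hp hXL hYK *.
set W := L * a + K * b in hp.
(* Each triple count is bounded from both sides: twice [hp] meets the sum of
   [pU] and [pS]. *)
have hW : (2 * r - 1) * W <= 2 * (t * M) + (3 - 2 * r) * Z + B * (K + L).
  by move: hp; rewrite /Z /W; lra.
have hZ : Z + 2 * (t * M) - 2 * (B * M) <= W by rewrite /Z /W; lra.
have r21 : 0 <= 2 * r - 1 by lra.
have r4 : 0 <= (r + 1) / 4 by lra.
have := ler_wpM2l r21 hZ.
move=> /le_trans/(_ hW) hZW.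
have hE : (4 * r - 4) * (Z + t * M) <= (4 * r - 2) * (B * M) + B * (K + L) by lra.
have := ler_wpM2l r4 hE.
have -> : (r + 1) / 4 * ((4 * r - 4) * (Z + t * M))
    = (r ^+ 2 - 1) * (Z + t * M) by field.
have -> : (r + 1) / 4 * ((4 * r - 2) * (B * M) + B * (K + L)) =
   (r ^+ 2 + r / 2 - 1 / 2) * (B * M) + (r + 1) / 4 * (B * (K + L)) by field.
rewrite r2 => h.
have : (r + 1) / 4 * (B * (K + L)) <= B * (K + L).
  by rewrite ler_piMl ?mulr_ge0 ?addr_ge0 //; lra.
lra.
Qed.

Lemma three_layers_bound (R : rcfType) (n j : nat) (S T U : {set {set 'I_n}}) :
  (j.+1 < n)%N -> S \subset layer n j -> T \subset layer n j.+1 ->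
  U \subset layer n j.+2 -> at_most_one_between S T U ->
  (#|S| * (n - j))%:R * (n - j.+1)%:R + (#|U| * j.+2)%:R * j.+1%:R
    + #|T|%:R * (j.+1%:R * (n - j.+1)%:R)
  <= (3 + Num.sqrt 2) / 2 * ('C(n, j.+1)%:R * (j.+1%:R * (n - j.+1)%:R))
     + 'C(n, j.+1)%:R * (j.+1%:R + (n - j.+1)%:R) :> R.
Proof.
move=> jn SL TL UL one.
have inL i (P : {set {set 'I_n}}) A : P \subset layer n i -> A \in P -> #|A| = i.
  by move=> /fintype.subsetP PL /PL; rewrite inE => /eqP.
pose below (P : {set {set 'I_n}}) (B : {set 'I_n}) := #|[set A in P | A \subset B]|.
pose above (P : {set {set 'I_n}}) (B : {set 'I_n}) := #|[set D in P | B \subset D]|.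
have nj : (n - j.+1).+1 = (n - j)%N by rewrite subnSK // ltnW.
have degS (Q0 : {set {set 'I_n}}) : Q0 \subset layer n j.+1 ->
    (#|S| * (n - j) + #|Q0| * j.+1
     <= \sum_(B in Q0) below S B + 'C(n, j.+1) * j.+1)%N.
  rewrite -card_layer => Q0L.
  apply: (@degree_bound _ (fun A B : {set 'I_n} => A \subset B)) => //.
    by move=> A /(inL _ _ _ SL) /layer_up_degree.
  by move=> B; rewrite inE => /eqP; apply: down_degree_le.
have degU (Q0 : {set {set 'I_n}}) : Q0 \subset layer n j.+1 ->
    (#|U| * j.+2 + #|Q0| * (n - j.+1)
     <= \sum_(B in Q0) above U B + 'C(n, j.+1) * (n - j.+1))%N.
  rewrite -card_layer => Q0L.
  apply: (@degree_bound _ (fun D B : {set 'I_n} => B \subset D)) => //.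
    by move=> D /(inL _ _ _ UL) /layer_down_degree.
  by move=> B; rewrite inE => /eqP; apply: up_degree_le.
apply: (@density_arith R (Num.sqrt 2) _ _ _ _ _ _
   (\sum_(B in T) below S B)%:R (\sum_(B in T) above U B)%:R
   (\sum_(B in T) below S B * above U B)%:R).
- exact: sqrtr_ge0.
- by rewrite sqr_sqrtr.
- exact: ler0n.
- exact: ler0n.
- exact: ler0n.
- rewrite -natrM ler_nat; have := degS finset.set0 (finset.sub0set _).
  by rewrite cards0 big_set0 addn0.
- rewrite -natrM ler_nat; have := degU finset.set0 (finset.sub0set _).
  by rewrite cards0 big_set0 addn0.
- by rewrite -!natrM -!natrD ler_nat degS.
- by rewrite -!natrM -!natrD ler_nat degU.
- rewrite -!natrM -!natrD ler_nat mulnC [(_ * #|T|)%N]mulnC -sum_nat_const.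
  rewrite big_distrl big_distrr -!big_split leq_sum //= => B BT.
  have Bj := inL _ _ _ TL BT.
  have : (below S B <= j.+1)%N by apply: down_degree_le.
  have : (above U B <= n - j.+1)%N by apply: up_degree_le.
  nia.
- apply: (@flag_bound R _ (fun B D : {set 'I_n} => B \subset D)) => B D BT DU BD.
  apply: (degree_sum_down one) BT DU (inL _ _ _ UL DU) BD => A.
    by move=> /(inL _ _ _ SL) ->.
  exact: inL.
- rewrite -nj; under eq_bigr => B _ do rewrite mulnC.
  apply: (@flag_bound R _ (fun B A : {set 'I_n} => A \subset B)) => B A BT AS AB.
  apply: (degree_sum_up one _ _ AS BT) AB => [D|D|].
  + exact: inL.
  + exact: inL.
  + by rewrite (inL _ _ _ SL AS).
Qed.

(** * Passing from the family to three consecutive layers *)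

Lemma Q2_free_at_most_one (n j : nat) (F S T U : {set {set 'I_n}}) :
  Q2_free F -> S \subset F -> T \subset F -> U \subset F ->
  {in S, forall A : {set _}, #|A| < j.+1}%N ->
  {in T, forall A : {set _}, #|A| = j.+1} ->
  {in U, forall A : {set _}, j.+1 < #|A|}%N ->
  at_most_one_between (up_closure j S) T (down_closure j.+2 U).
Proof.
move=> Ffree /fintype.subsetP SF /fintype.subsetP TF /fintype.subsetP UF Sj Tj Uj.
move=> A B C D /up_closureP[_ [A0 A0S A0A]] BT CT.
move=> /down_closureP[_ [D0 D0U DD0]] AB BD AC CD.
apply/eqP/negPn/negP => BC; apply: Ffree; exists A0, B, C, D0.
have neq (X Y : {set 'I_n}) : (#|X| < #|Y|)%N -> X != Y.
  by apply: contraTneq => ->; rewrite ltnn.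
have A0B : A0 != B by apply: neq; rewrite (Tj _ BT) Sj.
have A0C : A0 != C by apply: neq; rewrite (Tj _ CT) Sj.
have BD0 : B != D0 by apply: neq; rewrite (Tj _ BT) Uj.
have CD0 : C != D0 by apply: neq; rewrite (Tj _ CT) Uj.
have A0D0 : A0 != D0 by apply: neq; apply: ltn_trans (Sj _ A0S) (Uj _ D0U).
split.
- by rewrite (SF _ A0S) (TF _ BT) (TF _ CT) (UF _ D0U).
- by rewrite /= !inE !negb_or BC A0B A0C A0D0 BD0 CD0.
- by rewrite (fintype.subset_trans A0A AB) (fintype.subset_trans BD DD0).
- by rewrite (fintype.subset_trans A0A AC) (fintype.subset_trans CD DD0).
Qed.

(** The factor [j.+1 * (n - j.+1)] keeps the statement free of divisions; the
counts [X * (n - j)] and [Y * j.+2] of [three_layers_bound] are the densities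
of the two closures times ['C(n, j.+1) * j.+1] and
['C(n, j.+1) * (n - j.+1)]. *)
Lemma middle_bound (R : rcfType) (n j : nat) (F S T U : {set {set 'I_n}}) :
  (j.+1 < n)%N ->
  Q2_free F -> S \subset F -> T \subset F -> U \subset F ->
  antichain S -> antichain U ->
  {in S, forall A : {set _}, #|A| < j.+1}%N ->
  {in T, forall A : {set _}, #|A| = j.+1} ->
  {in U, forall A : {set _}, j.+1 < #|A|}%N ->
  (#|S| + #|T| + #|U|)%:R * (j.+1%:R * (n - j.+1)%:R)
  <= 'C(n, n./2)%:R * ((3 + Num.sqrt 2) / 2 * (j.+1%:R * (n - j.+1)%:R)
                       + (j.+1%:R + (n - j.+1)%:R)) :> R.
Proof.
move=> jn Ffree SF TF UF antiS antiU Sj Tj Uj.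
have TL : T \subset layer n j.+1.
  by apply/fintype.subsetP => A /Tj Aj; rewrite inE Aj.
have upL : up_closure j S \subset layer n j.
  by apply/fintype.subsetP => A; rewrite inE => /andP[].
have downL : down_closure j.+2 U \subset layer n j.+2.
  by apply/fintype.subsetP => A; rewrite inE => /andP[].
have := three_layers_bound R jn upL TL downL
  (Q2_free_at_most_one Ffree SF TF UF Sj Tj Uj).
move=> layers.
have := antichain_up_closure (ltnW (ltnW jn)) antiS Sj.
have := antichain_down_closure jn antiU Uj.
move: layers; set N := 'C(n, n./2); set X := #|up_closure _ _|.
set Y := #|down_closure _ _|.
have B0 : (0 < 'C(n, j.+1))%N by rewrite bin_gt0 ltnW.
have sT : (#|T| * 'C(n, j.+1) <= N * #|T|)%N.
  by rewrite mulnC leq_mul2r bin_half_max orbT.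
move=> layers sU sS.
have {}sU : (#|U| * ('C(n, j.+1) * (n - j.+1)) <= N * (Y * j.+2))%N.
  by rewrite [('C(n, j.+1) * _)%N]mulnC -mul_bin_left; nia.
have {}sS : (#|S| * ('C(n, j.+1) * j.+1) <= N * (X * (n - j)))%N.
  by rewrite [('C(n, j.+1) * _)%N]mulnC mul_bin_left; nia.
rewrite -(ler_pM2l (_ : 0 < 'C(n, j.+1)%:R)) ?ltr0n //.
move: layers sU sS sT; rewrite -!(ler_nat R) !natrM !natrD.
move: (j.+1%:R) (ler0n R j.+1) ((n - j.+1)%:R) (ler0n R (n - j.+1)).
move=> K K0 L L0 layers sU sS sT.
have := ler_wpM2l (ler0n R N) layers.
have := ler_wpM2l L0 sS; have := ler_wpM2l K0 sU.
have := ler_wpM2l (mulr_ge0 K0 L0) sT.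
lra.
Qed.

(** * Layers far from the middle, and the error term *)

(** One step upwards already multiplies such a binomial coefficient by five. *)
Lemma bin_low_layer (n k : nat) : (6 * k + 5 <= n -> 5 * 'C(n, k) <= 'C(n, n./2))%N.
Proof.
move=> kn; apply: leq_trans (bin_half_max n k.+1).
rewrite -(leq_pmul2l (ltn0Sn k)) mul_bin_left mulnA leq_mul2r; apply/orP; right.
lia.
Qed.

Lemma minimal_antichain (V : finType) (F S : {set {set V}}) :
  S \subset [set A | minset (mem F) A] -> antichain S.
Proof.
move=> Smin A B AS BS AB.
have := fintype.subsetP Smin _ BS; rewrite inE => /minsetP[_]; apply=> //.
by have := fintype.subsetP Smin _ AS; rewrite inE => /minsetP[].
Qed.

Lemma maximal_antichain (V : finType) (F U : {set {set V}}) :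
  U \subset [set A | maxset (mem F) A] -> antichain U.
Proof.
move=> Umax A B AU BU AB.
have := fintype.subsetP Umax _ AU; rewrite inE => /maxsetP[_ Amax].
apply/esym/Amax => //.
by have := fintype.subsetP Umax _ BU; rewrite inE => /maxsetP[].
Qed.

(** The constant 42 is twice the 21 of [middle_range], so that it covers
[1 / k + 1 / (n - k)] in the middle range; it also makes the bound trivial for
[n <= 5]. *)
Definition error (R : realType) (n : nat) : R :=
  42 * central_binomial R n * harmonic n.

Lemma error_little_o (R : realType) : little_o_N (@error R).
Proof.
rewrite /little_o_N.
have -> : (fun n => error R n / central_binomial R n) = (fun n => 42 * harmonic n).
  apply/funext => n; rewrite /error mulrAC mulfK //.
  by rewrite /central_binomial pnatr_eq0 -lt0n bin_gt0; lia.
have -> : (0 : R) = 42 * 0 by rewrite mulr0.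
by apply: cvgMr; exact: cvg_harmonic.
Qed.

Lemma sqrt2_ge (R : rcfType) : 7 / 5 <= Num.sqrt 2 :> R.
Proof.
have s2 : Num.sqrt 2 ^+ 2 = 2 :> R by rewrite sqr_sqrtr.
by rewrite -(ler_pXn2r (ltn0Sn 1)) ?nnegrE ?sqrtr_ge0 // ?s2 ?expr2; lra.
Qed.

Lemma constant_le_two_20711 (R : realType) : (3 + Num.sqrt 2) / 2 <= two_20711 R.
Proof.
suff : Num.sqrt 2 <= 2 * two_20711 R - 3 by lra.
have s2 : Num.sqrt 2 ^+ 2 = 2 :> R by rewrite sqr_sqrtr.
have t0 : 0 <= 2 * two_20711 R - 3 by rewrite /two_20711; lra.
rewrite -(ler_pXn2r (ltn0Sn 1)) ?nnegrE ?sqrtr_ge0 // s2 /two_20711 expr2.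
lra.
Qed.

(** Two antichains and a fifth of a third one stay below the bound, as
[2 + 1 / 5 <= (3 + 7 / 5) / 2]. *)
Lemma two_antichains_bound (R : realType) (n : nat) (x t : R) :
  x <= 2 * central_binomial R n + t -> t <= central_binomial R n / 5 ->
  x <= (3 + Num.sqrt 2) / 2 * central_binomial R n + error R n.
Proof.
have := @sqrt2_ge R; have : 0 <= error R n.
  by rewrite /error !mulr_ge0 ?ler0n ?invr_ge0.
have : 0 <= central_binomial R n by apply: ler0n.
nra.
Qed.

(** For [n > 5], [n < 6 * k + 5] gives [6 * k >= n - 4], and
[7 * (n - 4) >= 2 * n.+1]; hence [42 * k >= 2 * n.+1]. *)
Lemma middle_range (n k : nat) :
  (5 < n -> k <= n -> n < 6 * k + 5 -> n < 6 * (n - k) + 5 ->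
   [/\ 0 < k, k < n, n.+1 <= 21 * k & n.+1 <= 21 * (n - k)])%N.
Proof. by move=> *; split; lia. Qed.

(** * The bound for families *)

Lemma family_bound (R : realType) (n k : nat) (F S T U : {set {set 'I_n}}) :
  Q2_free F -> F = S :|: T :|: U ->
  S \subset [set A | minset (mem F) A] -> U \subset [set A | maxset (mem F) A] ->
  {in S, forall A : {set _}, #|A| < k}%N ->
  {in T, forall A : {set _}, #|A| = k} ->
  {in U, forall A : {set _}, k < #|A|}%N ->
  #|F|%:R <= (3 + Num.sqrt 2) / 2 * central_binomial R n + error R n.
Proof.
move=> Ffree FE Smin Umax Sk Tk Uk.
have antiS := minimal_antichain Smin; have antiU := maximal_antichain Umax.
have SF : S \subset F by rewrite FE -finset.setUA finset.subsetUl.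
have TF : T \subset F by rewrite FE finset.setUAC finset.subsetUr.
have UF : U \subset F by rewrite FE finset.subsetUr.
have FSTU : (#|F| <= #|S| + #|T| + #|U|)%N.
  rewrite FE (leq_trans (leq_card_setU _ _)) // leq_add2r.
  exact: (leq_card_setU _ _).1.
have SN := sperner antiS; have UN := sperner antiU.
have TL : T \subset layer n k.
  by apply/fintype.subsetP => A /Tk Ak; rewrite inE Ak.
have TN : (#|T| <= 'C(n, k))%N by rewrite -card_layer subset_leq_card.
have F2 : #|F|%:R <= 2 * central_binomial R n + #|T|%:R.
  rewrite /central_binomial -natrM -natrD ler_nat mul2n -addnn.
  by rewrite (leq_trans FSTU) // addnAC leq_add // leq_add.
have smallT : (5 * #|T| <= 'C(n, n./2))%N ->
    #|F|%:R <= (3 + Num.sqrt 2) / 2 * central_binomial R n + error R n.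
  rewrite -(ler_nat R) natrM => T5; apply: two_antichains_bound F2 _.
  by rewrite /central_binomial; lra.
have [nk|kn] := ltnP n k.
  by apply: smallT; move: TN; rewrite bin_small // leqn0 => /eqP ->.
have [low|klow] := leqP (6 * k + 5) n.
  by apply/smallT/(leq_trans _ (bin_low_layer low)); rewrite leq_mul.
have [high|khigh] := leqP (6 * (n - k) + 5) n.
  apply/smallT/(leq_trans _ (bin_low_layer high)).
  by rewrite leq_mul ?bin_sub.
have N0 : 0 <= central_binomial R n by apply: ler0n.
(* Here [n.+1 <= 6], so the error term alone is at least seven times the
   middle binomial coefficient, while [F] is a union of three antichains. *)
have [n5|n6] := leqP n 5.
  have F3 : #|F|%:R <= 3 * central_binomial R n.
    rewrite /central_binomial -natrM ler_nat.
    rewrite !mulSn addn0 addnA (leq_trans FSTU) // !leq_add //.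
    exact: leq_trans TN (bin_half_max n k).
  apply: (le_trans F3); rewrite /error.
  have h : 6^-1 <= harmonic n :> R by rewrite /= lef_pV2 ?posrE ?ltr0n // ler_nat.
  have := ler_wpM2l N0 h; have := mulr_ge0 N0 (sqrtr_ge0 (2 : R)); lra.
have [k0 kn' Kn Ln] := middle_range n6 kn klow khigh.
case: k k0 => // j _ in Sk Tk Uk TL TN kn klow khigh kn' Kn Ln.
have := middle_bound R kn' Ffree SF TF UF antiS antiU Sk Tk Uk.
move: FSTU Kn Ln; rewrite -!(ler_nat R) !(natrM _ 21) => FSTU Kn Ln.
have K0 : 0 < j.+1%:R :> R by rewrite ltr0n.
have L0 : 0 < (n - j.+1)%:R :> R by rewrite ltr0n subn_gt0.
rewrite -/(central_binomial R n) => main.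
rewrite -(ler_pM2r (mulr_gt0 K0 L0)).
apply: le_trans (ler_wpM2r (ltW (mulr_gt0 K0 L0)) FSTU) _.
apply: le_trans main _; rewrite /error /=.
move: Kn Ln K0 L0 (ltr0Sn R n).
move: (j.+1%:R) ((n - j.+1)%:R) (n.+1%:R) => K L m Km Lm K0 L0 m0.
have v0 : 0 <= m^-1 by rewrite invr_ge0 ltW.
have vm : m^-1 * m = 1 by rewrite mulVf // gt_eqF.
have hK := ler_wpM2l (mulr_ge0 v0 (ltW K0)) Lm.
have hL := ler_wpM2l (mulr_ge0 v0 (ltW L0)) Km.
rewrite mulrAC vm mul1r in hK; rewrite mulrAC vm mul1r in hL.
have := ler_wpM2l N0 (lerD hK hL).
lra.
Qed.

Lemma three_sorted_layers (R : realType) (n i j l : nat) (F : {set {set 'I_n}}) :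
  (i <= j <= l)%N -> Q2_free F ->
  F \subset layer n i :|: layer n j :|: layer n l ->
  #|F|%:R <= (3 + Num.sqrt 2) / 2 * central_binomial R n + error R n.
Proof.
move=> /andP[ij jl] Ffree /fintype.subsetP Flay.
have sizes A : A \in F -> [/\ (i <= #|A|)%N, (#|A| <= l)%N,
    (#|A| < j)%N -> (#|A| <= i)%N & (j < #|A|)%N -> (l <= #|A|)%N].
  by move=> /Flay; rewrite !inE -orbA => /or3P[]/eqP ->; split; lia.
pose S := [set A in F | (#|A| < j)%N]%SET.
pose U := [set A in F | (j < #|A|)%N]%SET.
pose T := [set A in F | #|A| == j]%SET.
apply: (@family_bound R n j F S T U) => //.
- apply/setP => A; rewrite !inE.
  by case: (A \in F) => //=; case: ltngtP.
- apply/fintype.subsetP => A; rewrite !inE => /andP[AF Aj].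
  apply/minsetP; split=> // B BF BA; apply/eqP; rewrite eqEcard BA /=.
  have [_ _ /(_ Aj) Ai _] := sizes _ AF; have [iB _ _ _] := sizes _ BF.
  exact: leq_trans iB.
- apply/fintype.subsetP => A; rewrite !inE => /andP[AF Aj].
  apply/maxsetP; split=> // B BF AB; apply/esym/eqP; rewrite eqEcard AB /=.
  have [_ _ _ /(_ Aj) lA] := sizes _ AF; have [_ Bl _ _] := sizes _ BF.
  exact: leq_trans lA.
- by move=> A; rewrite inE => /andP[].
- by move=> A; rewrite inE => /andP[_ /eqP].
- by move=> A; rewrite inE => /andP[].
Qed.

Lemma three_layers_family_bound (R : realType) (n i j l : nat)
    (F : {set {set 'I_n}}) :
  Q2_free F -> F \subset layer n i :|: layer n j :|: layer n l ->
  #|F|%:R <= (3 + Num.sqrt 2) / 2 * central_binomial R n + error R n.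
Proof.
move=> Ffree Flay.
wlog ij : i j Flay / (i <= j)%N.
  case: (leqP i j) => [|/ltnW] ij; last rewrite [layer n i :|: _]finset.setUC in Flay.
    by move=> /(_ _ _ Flay ij).
  by move=> /(_ _ _ Flay ij).
wlog jl : j l ij Flay / (j <= l)%N.
  case: (leqP j l) => [|/ltnW] jl; first by move=> /(_ _ _ ij Flay jl).
  move=> _; have [il|/ltnW li] := leqP i l.
    apply: (@three_sorted_layers R n i l j F) Ffree _; first by rewrite il.
    by rewrite finset.setUAC.
  apply: (@three_sorted_layers R n l i j F) Ffree _; first by rewrite li.
  by rewrite -finset.setUA finset.setUC.
by apply: (three_sorted_layers R _ Ffree Flay); rewrite ij.
Qed.

Theorem theorem2 (R : realType) :
  exists g1 g2 g3 : nat -> R,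
    [/\ little_o_N g1, little_o_N g2 & little_o_N g3] /\
    [/\ forall (n : nat) (F S T U : {set {set 'I_n}}) (k : int),
          Q2_free F ->
          F = S :|: T :|: U ->
          S \subset [set A | minset (mem F) A] ->
          U \subset [set A | maxset (mem F) A] ->
          T = F :\: (S :|: U) ->
          (forall A, A \in T -> #|A|%:Z = k) ->
          (forall A, A \in S -> #|A|%:Z < k) ->
          (forall A, A \in U -> k < #|A|%:Z) ->
          #|F|%:R <= (3 + Num.sqrt 2) / 2 * central_binomial R n + g1 n,
        forall n : nat,
          (3 + Num.sqrt 2) / 2 * central_binomial R n + g1 n
            <= two_20711 R * central_binomial R n + g2 n
      & forall (n : nat) (F : {set {set 'I_n}}) (i j l : nat),
          Q2_free F ->
          F \subset layer n i :|: layer n j :|: layer n l ->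
          #|F|%:R <= two_20711 R * central_binomial R n + g3 n].
Proof.
exists (@error R), (@error R), (@error R); split; first by split; apply: error_little_o.
have numeric n : (3 + Num.sqrt 2) / 2 * central_binomial R n + error R n
    <= two_20711 R * central_binomial R n + error R n.
  by rewrite lerD2r ler_wpM2r ?ler0n // constant_le_two_20711.
split=> // [n F S T U k Ffree FE Smin Umax _ Tk Sk Uk|n F i j l Ffree Flay].
- case: k => k in Tk Sk Uk *.
    by apply: family_bound Ffree FE Smin Umax Sk _ Uk => A /Tk [].
  apply: (@two_antichains_bound R n _ 0); last first.
    by rewrite divr_ge0 ?ler0n.
  rewrite addr0 /central_binomial -natrM ler_nat.
  have S0 : S = finset.set0.
    by apply/setP => A; rewrite finset.in_set0; apply/negP => /Sk.
  have T0 : T = finset.set0.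
    by apply/setP => A; rewrite finset.in_set0; apply/negP => /Tk.
  rewrite FE S0 T0 !finset.set0U (leq_trans (sperner (maximal_antichain Umax))) //.
  by rewrite leq_pmull.
- exact: le_trans (three_layers_family_bound R Ffree Flay) (numeric n).
Qed.
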